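(* Let $k$ be a field of characteristic $p>0$, let $d\geq 1$ be an integer, and suppose $p \geq 2d$. Then every $d$-dimensional representation of the Heisenberg group $H_1$ over $k$ has matrix formula of the form $$e^{xX_0+yY_0+(z-xy/2)Z_0}\; e^{x^pX_1+y^pY_1+(z^p-x^py^p/2)Z_1}\cdots e^{x^{p^m}X_m+y^{p^m}Y_m+(z^{p^m}-x^{p^m}y^{p^m}/2)Z_m}$$ for some integer $m\geq 0$, where $X_0,Y_0,Z_0,X_1,Y_1,Z_1,\ldots,X_m,Y_m,Z_m$ is a collection of $d\times d$ nilpotent matrices over $k$ satisfying (1) $[X_i,Y_i]=Z_i$ and $[Z_i,X_i]=[Z_i,Y_i]=0$ for every $i$; (2) whenever $i\neq j$, each of $X_i,Y_i,Z_i$ commutes with each of $X_j,Y_j,Z_j$. Further, for any collection $X_0,Y_0,Z_0,\ldots,X_m,Y_m,Z_m$ of $d\times d$ nilpotent matrices over $k$ satisfying (1) and (2), the matrix $$e^{xX_0+yY_0+(z-xy/2)Z_0}\; e^{x^pX_1+y^pY_1+(z^p-x^py^p/2)Z_1}\cdots e^{x^{p^m}X_m+y^{p^m}Y_m+(z^{p^m}-x^{p^m}y^{p^m}/2)Z_m}$$ is the matrix formula of a representation of $H_1$ over $k$.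
   Context: $H_1$ denotes the Heisenberg group over $k$, i.e. the group of upper triangular unipotent matrices $\begin{pmatrix}1&x&z\\0&1&y\\0&0&1\end{pmatrix}$, viewed as an affine group scheme represented by the Hopf algebra $A=k[x,y,z]$ with $\Delta(x)=x\otimes 1+1\otimes x$, $\Delta(y)=y\otimes 1+1\otimes y$, $\Delta(z)=z\otimes 1+x\otimes y+1\otimes z$, and $\varepsilon(x)=\varepsilon(y)=\varepsilon(z)=0$. A $d$-dimensional representation of $H_1$ over $k$ is an $A$-comodule structure on $k^d$; in terms of its matrix formula, it is a $d\times d$ matrix $(a_{ij})$ with entries in $A=k[x,y,z]$ satisfying $\Delta(a_{ij})=\sum_{l} a_{il}\otimes a_{lj}$ and $\varepsilon(a_{ij})=\delta_{ij}$ for all $i,j$. $[M,N]=MN-NM$. For a matrix $N$ over $k[x,y,z]$ of the form $x^{p^i}X_i+y^{p^i}Y_i+(z^{p^i}-x^{p^i}y^{p^i}/2)Z_i$ occurring as an exponent in the claim, $e^N$ denotes the truncated exponential $\sum_{j=0}^{p-1}N^j/j!$. The only case with $p=2$ is $d=1$, in which all the nilpotent matrices are zero; the terms involving $1/2$ are then read as $0$. *)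

(* Defs.v *)
From mathcomp Require Export all_boot all_algebra.
From mathcomp Require Export ssrcomplements freeg mpoly.

Set Implicit Arguments.
Unset Strict Implicit.
Unset Printing Implicit Defensive.

Import GRing.Theory.

Local Open Scope ring_scope.

(* The Hopf algebra A = k[x, y, z] of the Heisenberg group H_1. *)
Section HeisenbergHopfAlgebra.
Variable k : fieldType.

Definition hx : {mpoly k[3]} := 'X_(@Ordinal 3 0 isT).
Definition hy : {mpoly k[3]} := 'X_(@Ordinal 3 1 isT).
Definition hz : {mpoly k[3]} := 'X_(@Ordinal 3 2 isT).

(* A (x) A is identified with k[x, y, z, x', y', z'] = {mpoly k[6]}, the first
   (resp. last) three variables being those of the left (resp. right) factor;
   thus [tens a b] is the pure tensor a (x) b. *)
Definition inl_tens (a : {mpoly k[3]}) : {mpoly k[6]} :=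
  comp_mpoly [tuple 'X_(lshift 3 i) | i < 3] a.
Definition inr_tens (a : {mpoly k[3]}) : {mpoly k[6]} :=
  comp_mpoly [tuple 'X_(rshift 3 i) | i < 3] a.
Definition tens (a b : {mpoly k[3]}) : {mpoly k[6]} := inl_tens a * inr_tens b.

(* The k-algebra morphisms with the prescribed values on x, y, z. *)
Definition comul (a : {mpoly k[3]}) : {mpoly k[6]} :=
  comp_mpoly [tuple tens hx 1 + tens 1 hx;
                    tens hy 1 + tens 1 hy;
                    tens hz 1 + tens hx hy + tens 1 hz] a.
Definition counit (a : {mpoly k[3]}) : k := meval (fun _ => 0) a.

End HeisenbergHopfAlgebra.

Definition is_representation (k : fieldType) (d : nat)
    (M : 'M[{mpoly k[3]}]_d) : Prop :=
  (forall i j, comul (M i j) = \sum_(l < d) tens (M i l) (M l j)) /\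
  (forall i j, counit (M i j) = (i == j)%:R).

Definition commutator (k : fieldType) (d : nat) (M N : 'M[k]_d) : 'M[k]_d :=
  M *m N - N *m M.

Definition nilpotent_mx (k : fieldType) (d : nat) (M : 'M[k]_d) : Prop :=
  exists n : nat, M ^+ n = 0.

Definition trunc_exp (p : nat) (k : fieldType) (d : nat)
    (N : 'M[{mpoly k[3]}]_d) : 'M[{mpoly k[3]}]_d :=
  \sum_(j < p) ((j`!%:R : k)^-1)%:MP *: N ^+ j.

(* In characteristic 2 the inverse of 2%:R = 0 is 0 in MathComp, so there the
   term involving 1/2 vanishes. *)
Definition exponent (k : fieldType) (d q : nat) (X Y Z : 'M[k]_d) :
    'M[{mpoly k[3]}]_d :=
  let cst := map_mx (@mpolyC 3 k) in
  hx k ^+ q *: cst X + hy k ^+ q *: cst Y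
  + (hz k ^+ q - (2%:R : k)^-1 *: (hx k ^+ q * hy k ^+ q)) *: cst Z.

(* Ordered product of the factors i = 0, ..., m, from left to right. *)
Definition heis_formula (p : nat) (k : fieldType) (d m : nat)
    (X Y Z : 'I_m.+1 -> 'M[k]_d) : 'M[{mpoly k[3]}]_d :=
  \prod_(i < m.+1) trunc_exp p (exponent (p ^ i)%N (X i) (Y i) (Z i)).

Definition heis_collection (k : fieldType) (d m : nat)
    (X Y Z : 'I_m.+1 -> 'M[k]_d) : Prop :=
  [/\ forall i, [/\ nilpotent_mx (X i), nilpotent_mx (Y i) & nilpotent_mx (Z i)],
      forall i, [/\ commutator (X i) (Y i) = Z i,
                    commutator (Z i) (X i) = 0 &
                    commutator (Z i) (Y i) = 0] &
      forall i j, i != j ->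
        forall M N, M \in [:: X i; Y i; Z i] -> N \in [:: X j; Y j; Z j] ->
          commutator M N = 0].

(* Main.v *)
Require Import Defs.
From mathcomp Require Import ring.
Set Implicit Arguments.
Unset Strict Implicit.
Unset Printing Implicit Defensive.
Import GRing.Theory.
Local Open Scope ring_scope.

(** A representation M is a morphism from the group of triples (x, y, z), with
    values in any commutative k-algebra, to matrices, polynomial in x, y, z.
    Everything rests on restricting it to the three coordinate axes.

    On an axis, write the restriction as the sum of the a^m A_m. Being a
    morphism means A_a A_b = C(a + b, a) A_(a + b), so in characteristic p the
    base-p digits of m give A_m = prod_i X_i^(m_i) / m_i! with X_i = A_(p^i),
    and X_i^p = p! A_(p^(i + 1)) = 0; the X_i commute and the restriction is
    the product of the truncated exponentials of a^(p^i) X_i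
    ([divided_powers], [dp_prod]). As X_i is a nilpotent matrix of size d, even
    X_i^d = 0, so A_m = 0 as soon as one digit of m is at least d
    ([dp_digit_vanish]).

    Let A, B, C be the coefficients along x, y, z. The group law gives
    (x, 0, 0) (0, y, 0) = (0, y, 0) (0, 0, x y) (x, 0, 0), that is
      A_a B_b = sum_l B_(b - l) C_l A_(a - l),
    and says that C is central. Take a = p^i, b = p^j and l > 0. At the lowest
    nonzero digit of l the digits of l and of p^j - l (or of p^i - l) add up to
    p >= 2 d, so one of them is at least d and the term is zero
    ([complementary_digits]). The only exception is l = p^i = p^j. Hence
    [X_i, Y_j] is Z_i if i = j and 0 otherwise ([layer_commutator]), which
    gives the relations inside a layer as well as those between layers.

    It remains to merge, for each i, the three exponentials along the axes into
    one, and conversely to multiply two of the merged factors. Both are instances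
    of the identity e^A e^B = e^(A + B + [A, B] / 2) for central [A, B], which
    survives truncation because every product of d matrices among X, Y, Z is
    zero: these matrices lower a flag of subspaces of a d-dimensional space
    ([flag_eq0], [expsumM], [texpM]). *)

(** * The product of two truncated exponentials *)

(** The c j stand for the inverse factorials, and J n for the elements of degree
    at least n for a filtration by weights: elements of degree d vanish. *)
Section ExpSeries.
Variables (L : comNzRingType) (R : algType L) (p d : nat) (c : nat -> L).
Hypothesis c0 : c 0 = 1.
Hypothesis cS : forall j, (j.+1 < p)%N -> c j.+1 *+ j.+1 = c j.
Hypothesis p_unit : forall j, (j.+1 < p)%N -> exists u : L, u *+ j.+1 = 1.

Variable J : nat -> R -> Prop.
Hypothesis J0 : forall n, J n 0.
Hypothesis J1 : J 0 1.
Hypothesis JD : forall n a b, J n a -> J n b -> J n (a + b).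
Hypothesis JZ : forall n l a, J n a -> J n (l *: a).
Hypothesis JM : forall m n a b, J m a -> J n b -> J (m + n) (a * b).
Hypothesis Jd : forall n a, J n a -> (d <= n)%N -> a = 0.
Hypothesis d_gt0 : (0 < d)%N.
Hypothesis d_le_p : (d <= p)%N.

Definition expsum (A : R) : R := \sum_(j < p) c j *: A ^+ j.

(** The exponential of [A] with ['X^e] marking the weight [e] of [A]; its
    value at 1 is [expsum A]. *)
Definition expser (e : nat) (A : R) : {poly R} :=
  \sum_(j < p) (c j *: A ^+ j)%:P * 'X^(e * j).

Lemma expser1 e A : (expser e A).[1] = expsum A.
Proof.
rewrite horner_sum; apply: eq_bigr => j _.
by rewrite hornerCM hornerXn expr1n mulr1.
Qed.

Lemma filtX e A i : J e A -> J (e * i) (A ^+ i).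
Proof.
move=> JA; elim: i => [|i IH]; first by rewrite muln0 expr0.
by rewrite mulnS exprS; apply: JM.
Qed.

Lemma filt_sum (I : Type) (r : seq I) (P : pred I) F n :
  (forall i, P i -> J n (F i)) -> J n (\sum_(i <- r | P i) F i).
Proof. by move=> JF; elim/big_ind: _ => // a b; apply: JD. Qed.

Lemma pow_vanish e A i : (0 < e)%N -> (p <= i)%N -> J e A -> A ^+ i = 0.
Proof.
move=> e0 pi /(@filtX _ _ i) /Jd; apply.
by rewrite (leq_trans d_le_p) // (leq_trans pi) // leq_pmull.
Qed.

Lemma expser_homog e A i : (0 < e)%N -> J e A -> J i (expser e A)`_i.
Proof.
move=> e0 JA; rewrite coef_sum; apply: filt_sum => j _.
rewrite coefCM coefXn; case: eqP => [->|_]; last by rewrite mulr0.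
by rewrite mulr1; apply/JZ/filtX.
Qed.

Lemma homogM (P Q : {poly R}) :
  (forall i, J i P`_i) -> (forall i, J i Q`_i) -> forall i, J i (P * Q)`_i.
Proof.
move=> JP JQ i; rewrite coefM; apply: filt_sum => j _.
by rewrite -{1}(subnKC (_ : j <= i)%N) -1?ltnS //; apply: JM.
Qed.

Lemma expser_coef0 e A : (0 < e)%N -> (expser e A)`_0 = 1.
Proof.
move=> e0; have p0 : (0 < p)%N by apply: leq_trans d_le_p.
rewrite coef_sum (bigD1 (Ordinal p0)) //= big1 => [|j jn0].
  by rewrite muln0 coefCM coefXn mulr1 addr0 c0 scale1r expr0.
rewrite coefCM coefXn -[0 == _]eq_sym muln_eq0 (gtn_eqF e0) /=.
by rewrite [_ == 0](negPf jn0) mulr0.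
Qed.

(** Exact despite the truncation, since the term of degree p vanishes by
    weight. *)
Lemma deriv_expser e A : (0 < e)%N -> J e A ->
  (expser e A)^`() = expser e A * (A%:P * 'X^(e.-1) *+ e).
Proof.
move=> e0 JA; rewrite linear_sum mulr_suml /= /expser.
case: p cS d_le_p (@pow_vanish e A) => [|q] cSq dq van; first by rewrite !big_ord0.
rewrite big_ord_recl [RHS]big_ord_recr /= muln0 expr0 mulr1 derivC add0r.
rewrite [X in _ = _ + X](_ : _ = 0) ?addr0; last first.
  rewrite mulrnAr -mulrA [X in _ * X]mulrA -['X^_ * _]commr_polyXn -mulrA mulrA.
  by rewrite -polyCM -scalerAl -exprSr van // scaler0 polyC0 mul0r mul0rn.
apply: eq_bigr => j _; rewrite /bump /= add1n derivCE /= derivXn.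
rewrite mulrnAr [in RHS]mulrnAr -[in RHS]mulrA.
rewrite [X in _ = (_ * X) *+ _]mulrA -['X^_ * _]commr_polyXn.
rewrite -[in RHS]mulrA [in RHS]mulrA -exprD -polyCM -scalerAl -exprSr.
rewrite -(cSq j) ?ltnS // mulnC mulrnA.
rewrite (_ : (e * j + e.-1)%N = (j.+1 * e).-1); last first.
  by case: (e) e0 => [//|e' _]; rewrite [in RHS]mulSn addSn /= addnC mulnC.
by rewrite -scalerMnl polyCMn mulrnAl.
Qed.

(** Comparing coefficients of degree n determines (n + 1) times the coefficient
    of degree n + 1, and n + 1 is invertible below p. *)
Lemma ode_unique (F G H : {poly R}) :
  F^`() = F * H -> G^`() = G * H -> F`_0 = G`_0 ->
  forall n, (n < p)%N -> F`_n = G`_n.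
Proof.
move=> dF dG FG0 n; elim/ltn_ind: n => -[_ //|n] IH np.
have [u u1] := p_unit np.
suff E : F`_n.+1 *+ n.+1 = G`_n.+1 *+ n.+1.
  by rewrite -[LHS]scale1r -[RHS]scale1r -u1 -!scalerMnl !scalerMnr E.
rewrite -!coef_deriv dF dG !coefM; apply: eq_bigr => j _.
by rewrite IH ?ltn_ord // (ltn_trans (ltn_ord j) np).
Qed.

Lemma homog_vanish (P : {poly R}) n :
  (forall i, J i P`_i) -> (p <= n)%N -> P`_n = 0.
Proof. by move=> JP pn; apply: (Jd (JP n)); apply: leq_trans pn. Qed.

Lemma expser_comm e A (B : R) : A * B = B * A -> expser e A * B%:P = B%:P * expser e A.
Proof.
move=> AB; rewrite mulr_suml mulr_sumr; apply: eq_bigr => j _.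
rewrite -mulrA -commr_polyXn !mulrA -!polyCM; congr (_%:P * _).
by rewrite -scalerAl -scalerAr; congr (_ *: _); apply/esym/commrX.
Qed.

(** The commutator of A with B^(j + 1) is 2 (j + 1) B^j D, because
    [A, B] = 2 D is central. *)
Lemma commutator_expser A B D : J 1 B -> J 2 D ->
  A * B - B * A = D *+ 2 -> B * D = D * B ->
  A%:P * expser 1 B = expser 1 B * (A%:P + (D%:P * 'X) *+ 2).
Proof.
move=> JB JD2 AB BD.
have comX j : A * B ^+ j.+1 = B ^+ j.+1 * A + B ^+ j * D *+ 2 *+ j.+1.
  elim: j => [|j IH].
    by rewrite !expr1 expr0 mul1r mulr1n -AB addrC subrK.
  have AB' : A * B = B * A + D *+ 2 by rewrite -AB addrC subrK.
  rewrite exprSr mulrA IH mulrDl -mulrA AB' mulrDr mulrA -exprSr.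
  by rewrite !mulrnAl -(mulrA (B ^+ j)) -BD mulrA -exprSr mulrnAr -addrA -mulrS.
rewrite mulrDr mulr_sumr /expser.
case: p cS d_le_p => [|q] cSq dq; first by rewrite !big_ord0 !mul0r add0r.
rewrite big_ord_recl [X in X * A%:P]big_ord_recl.
rewrite [X in _ = _ + X * _]big_ord_recr /= muln0 !expr0 !mulr1 c0 !scale1r polyC1.
rewrite [X in _ = _ + X]mulrDl [X in _ = _ + (_ + X)](_ : _ = 0) ?addr0; last first.
  rewrite mulrnAr -mulrA [X in _ * X]mulrA -['X^_ * _]commr_polyXn.
  rewrite -mulrA mulrA -polyCM -scalerAl.
  rewrite (_ : B ^+ q * D = 0) ?scaler0 ?polyC0 ?mul0r ?mul0rn //.
  apply: (Jd (n := 1 * q + 2)); first by apply: JM => //; apply: filtX.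
  by rewrite mul1n addn2 ltnW // ltnS.
rewrite mulrDl mul1r -addrA !mulr_suml mulr1; congr (_ + _).
rewrite -big_split; apply: eq_bigr => j _; rewrite /bump /= add1n !mul1n.
rewrite mulrA -polyCM -scalerAr comX scalerDr polyCD mulrDl; congr (_ + _).
  by rewrite -mulrA -commr_polyXn mulrA -polyCM -scalerAl.
rewrite mulrnAr -(mulrA (c j *: _)%:P) (mulrA 'X^j) -(commr_polyXn D%:P).
rewrite -(mulrA D%:P) -exprSr mulrA -polyCM -scalerAl -[c j]cSq ?ltnS //.
by rewrite -!scalerMnr -!scalerMnl !polyCMn !mulrnAl mulrnAC.
Qed.

(** The polynomials F = e^(A X) e^(B X) and G = e^((A + B) X) e^(D X^2) both
    satisfy P' = P (A + B + 2 D X) and P(0) = 1, so they agree below degree p.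
    From degree p on, all coefficients vanish by weight. *)
Lemma expsumM_central A B D : J 1 A -> J 1 B -> J 2 D ->
  A * B - B * A = D *+ 2 -> A * D = D * A -> B * D = D * B ->
  expsum A * expsum B = expsum (A + B) * expsum D.
Proof.
move=> JA JB JD2 AB AD BD.
pose F := expser 1 A * expser 1 B; pose G := expser 1 (A + B) * expser 2 D.
have JS : J 1 (A + B) by apply: JD.
have comm1 (P : {poly R}) : comm_poly P 1 by rewrite /comm_poly mulr1 mul1r.
suff FG : F = G.
  have := congr1 (fun P => P.[1]) FG.
  by rewrite !hornerM_comm // !expser1.
apply/polyP => n; case: (ltnP n p) => np; last first.
  rewrite !(homog_vanish _ np) // => i; apply: homogM => {}i; exact: expser_homog.
apply: (@ode_unique F G ((A + B)%:P + (D%:P * 'X) *+ 2)) => //.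
- rewrite derivM !deriv_expser //= !expr0 !mulr1 !mulr1n.
  rewrite -mulrA (commutator_expser JB JD2) // mulrA [X in _ + X]mulrA.
  by rewrite -mulrDr polyCD addrAC.
- rewrite derivM !deriv_expser //= !expr0 !mulr1 !mulr1n expr1.
  have SD : D * (A + B) = (A + B) * D by rewrite mulrDl mulrDr AD BD.
  by rewrite -mulrA -(expser_comm 2 SD) !mulrA -mulrDr.
- by rewrite !coefM !big_ord_recl !big_ord0 /= !expser_coef0.
Qed.

Lemma expsum0 : expsum 0 = 1.
Proof.
have p0 : (0 < p)%N by apply: leq_trans d_le_p.
rewrite /expsum (bigD1 (Ordinal p0)) //= big1 => [|j jn0].
  by rewrite c0 scale1r expr0 addr0.
by rewrite expr0n [_ == 0%N](negPf jn0) scaler0.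
Qed.

(** The last merge is the previous lemma once more, for the commuting pair
    A + B and D. *)
Lemma expsumM A B D : J 1 A -> J 1 B -> J 1 D -> J 2 D ->
  A * B - B * A = D *+ 2 -> A * D = D * A -> B * D = D * B ->
  expsum A * expsum B = expsum (A + B + D).
Proof.
move=> JA JB JD1 JD2 AB AD BD; rewrite (@expsumM_central A B D) //.
rewrite (@expsumM_central (A + B) D 0) ?expsum0 ?mulr1 //.
- exact: JD.
- by rewrite mulrDl mulrDr AD BD subrr mul0rn.
- by rewrite mulr0 mul0r.
- by rewrite mulr0 mul0r.
Qed.

End ExpSeries.

(** * The flag lowered by a nilpotent Heisenberg triple *)

(** Iterating the first inclusion gives W <= W N^j + U for all j. *)
Lemma submx_nilpotent (k : fieldType) n (W U N : 'M[k]_n.+1) :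
  (W <= W *m N + U)%MS -> (U *m N <= U)%MS -> nilpotent_mx N -> (W <= U)%MS.
Proof.
move=> WNU UN [r Nr0].
have WXU j : (W <= W *m N ^+ j + U)%MS.
  elim: j => [|j IH]; first by rewrite expr0 mulmx1 addsmxSl.
  apply: (submx_trans WNU); rewrite addsmx_sub addsmxSr andbT exprSr mulmxA.
  apply: (submx_trans (submxMr N IH)); rewrite addsmxMr addsmx_sub addsmxSl.
  exact: submx_trans UN (addsmxSr _ _).
have := WXU r; rewrite Nr0 mulmx0 => /submx_trans; apply.
by rewrite addsmx_sub sub0mx submx_refl.
Qed.

Section Flag.
Variables (k : fieldType) (n : nat) (X Y Z : 'M[k]_n.+1).
Hypotheses (nX : nilpotent_mx X) (nY : nilpotent_mx Y) (nZ : nilpotent_mx Z).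
Hypothesis XY : commutator X Y = Z.
Hypothesis ZX : commutator Z X = 0.
Hypothesis ZY : commutator Z Y = 0.

Fixpoint flag i : 'M[k]_n.+1 :=
  if i is j.+1 then (flag j *m X + flag j *m Y + flag j *m Z)%MS else 1%:M.

Lemma flagX i : (flag i *m X <= flag i.+1)%MS.
Proof. by rewrite /= -addsmxA addsmxSl. Qed.
Lemma flagY i : (flag i *m Y <= flag i.+1)%MS.
Proof. by rewrite /= addsmxC addsmxA addsmxSr. Qed.
Lemma flagZ i : (flag i *m Z <= flag i.+1)%MS.
Proof. exact: addsmxSr. Qed.

Lemma flag_decr i : (flag i.+1 <= flag i)%MS.
Proof.
elim: i => [|i IH]; first exact: submx1.
by rewrite {1}/flag -/(flag i.+1) /= !addsmxS ?submxMr.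
Qed.

(** The hypotheses say that W is stable and generated by its images. Both Z and
    then X can be dropped from the generators, because they are nilpotent; the
    second step needs X and Y to commute on the space, which holds for W Z^a
    when W Z^(a + 1) = 0. Then Y alone generates W Z^a, which is therefore zero,
    and one descends on a. *)
Lemma stable_eq0 (W : 'M[k]_n.+1) :
  (W <= W *m X + W *m Y + W *m Z)%MS ->
  (W *m X <= W)%MS -> (W *m Y <= W)%MS -> W = 0.
Proof.
move=> Wgen WX WY.
have cZX : Z *m X = X *m Z by apply/eqP; rewrite -subr_eq0; apply/eqP.
have cZY : Z *m Y = Y *m Z by apply/eqP; rewrite -subr_eq0; apply/eqP.
have cYX : Y *m X = X *m Y - Z by rewrite -XY opprB addrC subrK.
have W1 : (W <= W *m X + W *m Y)%MS.
  apply: (@submx_nilpotent _ _ _ _ Z) nZ; first by rewrite addsmxC.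
  rewrite addsmxMr -!mulmxA -cZX -cZY !mulmxA.
  have WZ : (W *m Z <= W)%MS.
    rewrite -XY mulmxBr addmx_sub ?eqmx_opp // mulmxA.
      exact: submx_trans (submxMr _ WX) WY.
    exact: submx_trans (submxMr _ WY) WX.
  by rewrite addsmxS ?submxMr.
have ZE a : W *m Z ^+ a.+1 = 0 -> W *m Z ^+ a = 0.
  move=> Wa1; set V := W *m Z ^+ a.
  have VZ : V *m Z = 0 by rewrite -mulmxA -[_ *m Z]exprSr.
  have cX : Z ^+ a *m X = X *m Z ^+ a by apply/esym/commrX/esym.
  have cY : Z ^+ a *m Y = Y *m Z ^+ a by apply/esym/commrX/esym.
  have V1 : (V <= V *m X + V *m Y)%MS.
    rewrite /V -!mulmxA cX cY !mulmxA -addsmxMr; exact: submxMr.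
  have V2 : (V <= V *m Y)%MS.
    apply: (@submx_nilpotent _ _ _ _ X) nX => //.
    rewrite -mulmxA cYX mulmxBr VZ subr0 mulmxA submxMr //.
    by rewrite /V -mulmxA cX mulmxA submxMr.
  apply/eqP; rewrite -submx0; apply: (@submx_nilpotent _ _ _ _ Y) nY.
    by rewrite addsmx0.
  by rewrite mul0mx.
have [r Zr] := nZ.
have : W *m Z ^+ r = 0 by rewrite Zr mulmx0.
by elim: r {Zr} => [|r IH]; [rewrite expr0 mulmx1 | move=> /ZE/IH].
Qed.

(** The flag decreases strictly until it reaches zero, since a stationary step
    satisfies [stable_eq0]. *)
Lemma rank_flag i : (\rank (flag i) <= n.+1 - i)%N.
Proof.
elim: i => [|i IH]; first by rewrite subn0 rank_leq_row.
have [le|nle] := boolP (flag i <= flag i.+1)%MS.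
  rewrite (_ : flag i.+1 = 0) ?mxrank0 //; apply/eqP; rewrite -submx0.
  apply: (submx_trans (flag_decr i)).
  rewrite (stable_eq0 le) ?sub0mx //; apply: submx_trans (flag_decr i).
    exact: flagX.
  exact: flagY.
have lt : (flag i.+1 < flag i)%MS by rewrite /ltmx flag_decr.
by rewrite subnS -ltnS (leq_trans (rank_ltmx lt)) // (leq_trans IH) // leqSpred.
Qed.

Lemma flag_eq0 i : (n < i)%N -> flag i = 0.
Proof.
move=> ni; apply/eqP; rewrite -mxrank_eq0 -leqn0 (leq_trans (rank_flag i)) //.
by rewrite leqn0 subn_eq0.
Qed.

Variables (L : comNzRingType) (phi : {rmorphism k -> L}).

(** Matrices over L that move each step of the flag m steps down, stated with a
    matrix of coefficients [Q] since row spaces make no sense over a ring. *)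
Definition lowers m (N : 'M[L]_n.+1) :=
  forall i, exists Q, map_mx phi (flag i) *m N = Q *m map_mx phi (flag (i + m)).

Lemma lowers0 m : lowers m 0.
Proof. by move=> i; exists 0; rewrite mulmx0 mul0mx. Qed.

Lemma lowers1 : lowers 0 1.
Proof. by move=> i; exists 1; rewrite addn0 mulmx1 mul1mx. Qed.

Lemma lowersD m A B : lowers m A -> lowers m B -> lowers m (A + B).
Proof.
move=> lA lB i; have [[Q1 E1] [Q2 E2]] := (lA i, lB i).
by exists (Q1 + Q2); rewrite mulmxDr mulmxDl E1 E2.
Qed.

Lemma lowersZ m l A : lowers m A -> lowers m (l *: A).
Proof.
by move=> lA i; have [Q E] := lA i; exists (l *: Q); rewrite -scalemxAr E scalemxAl.
Qed.

Lemma lowersM m1 m2 A B : lowers m1 A -> lowers m2 B -> lowers (m1 + m2) (A * B).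
Proof.
move=> lA lB i; have [Q1 E1] := lA i; have [Q2 E2] := lB (i + m1)%N.
by exists (Q1 *m Q2); rewrite mulmxA E1 -mulmxA E2 mulmxA addnA.
Qed.

Lemma lowers_eq0 m A : lowers m A -> (n < m)%N -> A = 0.
Proof.
move=> lA nm; have [Q] := lA 0; by rewrite (@flag_eq0 (0 + m)) // map_mx0 mulmx0 map_mx1 mul1mx.
Qed.

Lemma lowers_gen (N : 'M[k]_n.+1) :
  (forall i, (flag i *m N <= flag i.+1)%MS) -> lowers 1 (map_mx phi N).
Proof.
move=> le i; have /submxP[Q E] := le i.
by exists (map_mx phi Q); rewrite addn1 -!map_mxM E.
Qed.

Lemma lowersX : lowers 1 (map_mx phi X). Proof. exact/lowers_gen/flagX. Qed.
Lemma lowersY : lowers 1 (map_mx phi Y). Proof. exact/lowers_gen/flagY. Qed.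
Lemma lowersZ1 : lowers 1 (map_mx phi Z). Proof. exact/lowers_gen/flagZ. Qed.
(** Z has weight 2 because it is the commutator of X and Y. *)
Lemma lowersZ2 : lowers 2 (map_mx phi Z).
Proof.
rewrite -XY /commutator map_mxB !map_mxM -scaleN1r.
apply: lowersD; first exact: (lowersM lowersX lowersY).
by apply: lowersZ; exact: (lowersM lowersY lowersX).
Qed.

End Flag.

(** * Truncated exponentials of Heisenberg triples *)

Section HeisExp.
Variables (k : fieldType) (p n : nat).
Hypotheses (hp : p \in [pchar k]) (hpd : (2 * n.+1 <= p)%N).

Lemma natr_neq0 j : (0 < j < p)%N -> j%:R != 0 :> k.
Proof.
by case/andP => j0 jp; rewrite -(dvdn_pcharf hp) gtnNdvd.
Qed.

Lemma factr_neq0 j : (j < p)%N -> j`!%:R != 0 :> k.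
Proof.
elim: j => [|j IH] jp; first by rewrite fact0 oner_eq0.
by rewrite factS natrM mulf_neq0 //; [apply: natr_neq0 | apply/IH/ltnW].
Qed.

Variables (L : comNzRingType) (phi : {rmorphism k -> L}).

Definition texp (N : 'M[L]_n.+1) := expsum p (fun j => phi (j`!%:R^-1)) N.

Definition heis_lin (X Y Z : 'M[k]_n.+1) (u v w : L) : 'M[L]_n.+1 :=
  u *: map_mx phi X + v *: map_mx phi Y + w *: map_mx phi Z.

Lemma inv_fact0 : phi (0`!%:R^-1) = 1.
Proof. by rewrite fact0 invr1 rmorph1. Qed.

Lemma inv_factS j : (j.+1 < p)%N -> phi (j.+1`!%:R^-1) *+ j.+1 = phi (j`!%:R^-1).
Proof.
move=> jp; rewrite -rmorphMn factS natrM invfM -mulr_natl mulrA mulfV ?mul1r //.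
exact: natr_neq0.
Qed.

Lemma natr_invertible j : (j.+1 < p)%N -> exists u : L, u *+ j.+1 = 1.
Proof.
move=> jp; exists (phi j.+1%:R^-1); rewrite -rmorphMn -mulr_natl mulfV ?rmorph1 //.
exact: natr_neq0.
Qed.

Lemma dim_le_char : (n.+1 <= p)%N.
Proof. by apply: leq_trans hpd; rewrite leq_pmull. Qed.
Lemma texp0 : texp 0 = 1.
Proof. exact: (expsum0 _ inv_fact0 (ltn0Sn n) dim_le_char). Qed.

(** If p = 2 then matrices have size 1 and nilpotent ones are zero. *)
Lemma half_mul2_or_eq0 (X Y Z : 'M[k]_n.+1) :
  nilpotent_mx X -> nilpotent_mx Y -> nilpotent_mx Z ->
  commutator X Y = Z -> commutator Z X = 0 -> commutator Z Y = 0 ->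
  Z = 0 \/ phi 2%:R^-1 *+ 2 = 1.
Proof.
move=> nX nY nZ XY ZX ZY; have [p2|p2] := eqVneq p 2%N; [left|right].
  have n0 : (n < 1)%N by move: hpd; rewrite p2 -[leqRHS]/(2 * 1)%N leq_pmul2l.
  have := lowersZ1 X Y Z idfun; rewrite map_mx_id // => JZ.
  exact: (lowers_eq0 nX nY nZ XY ZX ZY JZ n0).
rewrite -rmorphMn -[_ *+ 2]mulr_natl mulfV ?rmorph1 //.
have := pcharf_prime hp; case: (p) p2 natr_neq0 => [|[|[|q]]] // _ nz _.
exact: nz.
Qed.

(** In exponential coordinates the Heisenberg group law is the
    Baker-Campbell-Hausdorff formula up to the first commutator. *)
Lemma texpM (X Y Z : 'M[k]_n.+1) :
  nilpotent_mx X -> nilpotent_mx Y -> nilpotent_mx Z ->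
  commutator X Y = Z -> commutator Z X = 0 -> commutator Z Y = 0 ->
  forall u v w u' v' w',
  texp (heis_lin X Y Z u v w) * texp (heis_lin X Y Z u' v' w') =
  texp (heis_lin X Y Z (u + u') (v + v') (w + w' + phi 2%:R^-1 * (u * v' - u' * v))).
Proof.
move=> nX nY nZ XY ZX ZY u v w u' v' w'.
pose J := lowers X Y Z phi.
have JX : J 1 (map_mx phi X) := lowersX X Y Z phi.
have JY : J 1 (map_mx phi Y) := lowersY X Y Z phi.
have JZ1 : J 1 (map_mx phi Z) := lowersZ1 X Y Z phi.
have JZ2 : J 2 (map_mx phi Z) := lowersZ2 XY phi.
have Jlin a b c : J 1 (heis_lin X Y Z a b c).
  by do !apply: lowersD; apply: lowersZ.
pose D := (phi 2%:R^-1 * (u * v' - u' * v)) *: map_mx phi Z.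
have cXY : map_mx phi X * map_mx phi Y = map_mx phi Y * map_mx phi X + map_mx phi Z.
  by rewrite -XY /commutator map_mxB !map_mxM -!mulmxE addrC subrK.
have cZX : map_mx phi Z * map_mx phi X = map_mx phi X * map_mx phi Z.
  apply/eqP; rewrite -subr_eq0 -!mulmxE -!map_mxM -map_mxB.
  by rewrite [_ - _]ZX map_mx0.
have cZY : map_mx phi Z * map_mx phi Y = map_mx phi Y * map_mx phi Z.
  apply/eqP; rewrite -subr_eq0 -!mulmxE -!map_mxM -map_mxB.
  by rewrite [_ - _]ZY map_mx0.
have cZ a b c : heis_lin X Y Z a b c * map_mx phi Z = map_mx phi Z * heis_lin X Y Z a b c.
  by rewrite /heis_lin !mulrDl !mulrDr -!scalerAl -!scalerAr cZX cZY.
have D2 : D *+ 2 = (u * v' - u' * v) *: map_mx phi Z.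
  have [Z0 | h2] := half_mul2_or_eq0 nX nY nZ XY ZX ZY.
    by rewrite /D Z0 map_mx0 !scaler0 mul0rn.
  by rewrite /D scalerMnl -mulrnAl h2 mul1r.
have commutator_heis_lin : heis_lin X Y Z u v w * heis_lin X Y Z u' v' w'
    - heis_lin X Y Z u' v' w' * heis_lin X Y Z u v w = D *+ 2.
  rewrite D2 /heis_lin !mulrDl !mulrDr -!scalerAl -!scalerAr !scalerA cXY cZX cZY.
  move: (map_mx phi X * map_mx phi X) (map_mx phi Y * map_mx phi X)
    (map_mx phi Y * map_mx phi Y) (map_mx phi X * map_mx phi Z)
    (map_mx phi Y * map_mx phi Z) (map_mx phi Z * map_mx phi Z) (map_mx phi Z).
  move=> XX YX YY XZ YZ ZZ Z'; apply/matrixP => i j; rewrite !mxE; ring.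
rewrite /texp (expsumM inv_fact0 inv_factS natr_invertible (J := J)
   _ _ _ _ _ _ (ltn0Sn n) dim_le_char
   _ _ _ _ commutator_heis_lin) //.
- by congr (expsum _ _ _); rewrite /heis_lin /D; apply/matrixP => i j; rewrite !mxE; ring.
- exact: lowers0.
- exact: lowers1.
- exact: lowersD.
- exact: lowersZ.
- exact: lowersM.
- exact: (lowers_eq0 nX nY nZ XY ZX ZY).
- exact: lowersZ.
- exact: lowersZ.
- by rewrite /D -scalerAl -scalerAr cZ.
- by rewrite /D -scalerAl -scalerAr cZ.
Qed.

Lemma texp_comm A B : A * B = B * A -> texp A * texp B = texp B * texp A.
Proof.
move=> AB; rewrite mulr_suml mulr_sumr; apply: eq_bigr => i _.
rewrite mulr_suml mulr_sumr; apply: eq_bigr => j _.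
rewrite -!scalerAl -!scalerAr !scalerA mulrC; congr (_ *: _).
exact/commrX/esym/commrX/esym.
Qed.

Lemma heis_lin_comm X Y Z X' Y' Z' u v w u' v' w' :
  (forall M N, M \in [:: X; Y; Z] -> N \in [:: X'; Y'; Z'] -> commutator M N = 0) ->
  heis_lin X Y Z u v w * heis_lin X' Y' Z' u' v' w' =
  heis_lin X' Y' Z' u' v' w' * heis_lin X Y Z u v w.
Proof.
move=> cM.
have {}cM M N : M \in [:: X; Y; Z] -> N \in [:: X'; Y'; Z'] ->
    map_mx phi M * map_mx phi N = map_mx phi N * map_mx phi M.
  move=> MX NX; apply/eqP; rewrite -subr_eq0 -!mulmxE -!map_mxM -map_mxB.
  by rewrite [_ - _]cM ?map_mx0.
rewrite /heis_lin !mulrDl !mulrDr -!scalerAl -!scalerAr !scalerA.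
rewrite (cM X X') ?(cM X Y') ?(cM X Z') ?(cM Y X') ?(cM Y Y') ?(cM Y Z')
  ?(cM Z X') ?(cM Z Y') ?(cM Z Z') ?inE ?eqxx ?orbT //.
move: (map_mx phi X' * map_mx phi X) (map_mx phi Y' * map_mx phi X)
 (map_mx phi Z' * map_mx phi X) (map_mx phi X' * map_mx phi Y)
 (map_mx phi Y' * map_mx phi Y) (map_mx phi Z' * map_mx phi Y)
 (map_mx phi X' * map_mx phi Z) (map_mx phi Y' * map_mx phi Z)
 (map_mx phi Z' * map_mx phi Z).
move=> a1 a2 a3 a4 a5 a6 a7 a8 a9.
by apply/matrixP => i j; rewrite !mxE; ring.
Qed.

End HeisExp.

(** * Binomial coefficients modulo p *)

Section Binomials.
Variables (k : fieldType) (p : nat).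
Hypothesis hp : p \in [pchar k].

(** The power p^m divides j C(q p^m, j) but not j. *)
Lemma bin_pfactor_eq0 q m j : (0 < j < p ^ m)%N -> 'C(q * p ^ m, j)%:R = 0 :> k.
Proof.
case: j => // j /= jm; apply/eqP; rewrite -(dvdn_pcharf hp); apply/negPn/negP => ndv.
have co : coprime (p ^ m) 'C(q * p ^ m, j.+1).
  by apply: coprimeXl; rewrite prime_coprime // (pcharf_prime hp).
have: (p ^ m %| j.+1 * 'C(q * p ^ m, j.+1))%N.
  by rewrite -mul_bin_diag dvdn_mulr // dvdn_mull.
by rewrite Gauss_dvdl // gtnNdvd.
Qed.

(** In Vandermonde's sum for C(q p^m + r, r) only the term C(r, r) survives. *)
Lemma bin_pfactor_add q m r : (r < p ^ m)%N -> 'C(q * p ^ m + r, q * p ^ m)%:R = 1 :> k.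
Proof.
move=> rm; rewrite -{2}[(q * p ^ m)%N](addnK r) bin_sub ?leq_addl //.
rewrite -binomial.Vandermonde natr_sum big_ord_recl /= bin0 mul1n subn0 binn big1 ?addr0 //.
move=> i _; rewrite /bump /= natrM bin_pfactor_eq0 ?mul0r //.
by rewrite add1n /= (leq_trans _ rm) // ltnS.
Qed.

(** In Vandermonde's sum for C((q + 1) p^m, p^m) only the two extreme terms
    survive: they are 1 and C(q p^m, p^m). *)
Lemma bin_pfactor_mul q m : 'C(q.+1 * p ^ m, q * p ^ m)%:R = q.+1%:R :> k.
Proof.
have P0 : (0 < p ^ m)%N by rewrite expn_gt0 prime_gt0 // (pcharf_prime hp).
have sym i : 'C(i.+1 * p ^ m, i * p ^ m) = 'C(i.+1 * p ^ m, p ^ m).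
  by rewrite mulSn -{2}[(i * p ^ m)%N](addKn (p ^ m)) bin_sub ?leq_addr.
rewrite sym; elim: q => [|q IH]; first by rewrite mul1n binn.
rewrite mulSn addnC -binomial.Vandermonde natr_sum big_ord_recl /= bin0 mul1n subn0 binn.
rewrite (_ : \sum_(i < p ^ m) _ = 'C(q.+1 * p ^ m, p ^ m)%:R).
  by rewrite IH -natrD.
case: (p ^ m)%N P0 (@bin_pfactor_eq0 q.+1 m) {IH sym} => // P _ b0.
rewrite big_ord_recr /= big1 => [|i _]; last first.
  by rewrite natrM b0 ?mul0r // /bump /= add1n ltnS.
by rewrite add0r /bump leq0n add1n subnn bin0 muln1.
Qed.

End Binomials.

Lemma sum_nat_block (V : nmodType) (F : nat -> V) q P :
  \sum_(i < q * P) F i = \sum_(j < q) \sum_(r < P) F (j * P + r)%N.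
Proof.
elim: q => [|q IH]; first by rewrite mul0n !big_ord0.
rewrite big_ord_recr -IH /= -!(big_mkord xpredT) mulSn addnC.
rewrite (big_cat_nat (n := (q * P)%N)) ?leq_addr //=; congr (_ + _).
rewrite -{1}[(q * P)%N]add0n big_addn addKn !big_mkord.
by apply: eq_bigr => r _; rewrite addnC.
Qed.

(** * One-parameter families *)

Section DividedPowers.
Variables (k : fieldType) (p n : nat).
Hypothesis hp : p \in [pchar k].

(** For a family of finite support, this says that a |-> sum_m a^m A_m is a
    morphism from the additive group. *)
Definition divided_powers (A : nat -> 'M[k]_n.+1) :=
  A 0 = 1 /\ forall a b, A a * A b = A (a + b)%N *+ 'C(a + b, a).

Variable A : nat -> 'M[k]_n.+1.
Hypothesis dpA : divided_powers A.
Let X i := A (p ^ i)%N.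

Lemma dp_mulC a b : A a * A b = A b * A a.
Proof.
rewrite !dpA.2 [in RHS]addnC; congr (_ *+ _).
by rewrite -[X in 'C(_, X) = _](addnK b a) bin_sub // leq_addl.
Qed.

Lemma dp_add q m r : (r < p ^ m)%N ->
  A (q * p ^ m + r)%N = A (q * p ^ m)%N * A r.
Proof.
by move=> rm; rewrite dpA.2 -scaler_nat (bin_pfactor_add hp) // scale1r.
Qed.

Lemma dp_pow q m : X m ^+ q = q`!%:R *: A (q * p ^ m)%N.
Proof.
elim: q => [|q IH]; first by rewrite expr0 mul0n dpA.1 scale1r.
rewrite exprSr IH -scalerAl dpA.2 addnC -mulSn -scaler_nat (bin_pfactor_mul hp).
by rewrite scalerA mulrC -natrM factS.
Qed.

Lemma dp_nilpotent m : nilpotent_mx (X m).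
Proof.
exists p; rewrite dp_pow; have p0 := prime_gt0 (pcharf_prime hp).
have /eqP -> : p`!%:R == 0 :> k; last by rewrite scale0r.
by rewrite -(dvdn_pcharf hp) dvdn_fact // p0 /=.
Qed.

(** A nilpotent matrix is part of the degenerate triple (X, 0, 0), whose flag
    already shows that its n.+1-st power vanishes. *)
Lemma dp_expS m : X m ^+ n.+1 = 0.
Proof.
have n0 : nilpotent_mx (0 : 'M[k]_n.+1) by exists 1; rewrite expr1.
have c0 N : commutator 0 N = 0 :> 'M[k]_n.+1.
  by rewrite /commutator mul0mx mulmx0 subrr.
have cX : commutator (X m) 0 = 0.
  by rewrite /commutator mul0mx mulmx0 subrr.
have lX : lowers (X m) 0 0 idfun 1 (X m).
  by have := lowersX (X m) 0 0 idfun; rewrite map_mx_id.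
have := filtX (lowers1 (X m) 0 0 idfun) (@lowersM _ _ (X m) 0 0 _ idfun) n.+1 lX.
rewrite mul1n => /(lowers_eq0 (dp_nilpotent m) n0 n0 cX (c0 _) (c0 _)); exact.
Qed.

Lemma dp_digit_vanish N j : (n < (N %/ p ^ j) %% p)%N -> A N = 0.
Proof.
have pr := pcharf_prime hp; have p0 := prime_gt0 pr.
set M := (N %/ p ^ j)%N; set t := (M %% p)%N => nt.
have tp : (t < p)%N by rewrite ltn_mod.
have At : A (t * p ^ j)%N = 0.
  have : t`!%:R *: A (t * p ^ j)%N = 0.
    by rewrite -dp_pow -(subnKC nt) exprD dp_expS mul0r.
  by move/eqP; rewrite scaler_eq0 (negPf (factr_neq0 hp tp)) => /eqP.
rewrite (divn_eq N (p ^ j)) -/M dp_add ?ltn_mod ?expn_gt0 ?p0 //.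
rewrite (divn_eq M p) -/t mulnDl -mulnA -expnS dp_add.
  by rewrite At mulr0 mul0r.
by rewrite expnS ltn_pmul2r // expn_gt0 p0.
Qed.

Variables (L : comNzRingType) (phi : {rmorphism k -> L}).

(** Splitting off the leading digit of i factors the sum over i < p^(m + 1) into
    the sum over i < p^m and a truncated exponential. *)
Lemma dp_prod (a : L) m :
  \sum_(i < p ^ m) a ^+ i *: map_mx phi (A i) =
  \prod_(i < m) texp p phi (a ^+ (p ^ i) *: map_mx phi (X i)).
Proof.
elim: m => [|m IH].
  by rewrite expn0 big_ord1 big_ord0 expr0 scale1r dpA.1 map_mx1.
rewrite expnS (sum_nat_block (fun i => a ^+ i *: map_mx phi (A i))).
rewrite big_ord_recr /= -IH mulr_sumr; apply: eq_bigr => q _.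
rewrite mulr_suml; apply: eq_bigr => r _.
rewrite dp_add // dp_mulC map_mxM exprZn -rmorphXn /= dp_pow map_mxZ !scalerA.
rewrite -scalerAl -scalerAr !scalerA; congr (_ *: _).
rewrite exprD -exprM [(p ^ m * q)%N]mulnC [RHS]mulrC.
have e1 : phi (q`!%:R^-1) * phi q`!%:R = 1.
  by rewrite -rmorphM mulVf ?rmorph1 // (factr_neq0 hp).
by rewrite (mulrAC (phi _)) e1 mul1r.
Qed.

End DividedPowers.

(** At position e the digits of l and N - l add up to p, because N has digits 0
    up to that position and e is the position of the lowest nonzero digit of l.
    As p >= 2 n.+1, one of the two digits exceeds n. *)
Lemma complementary_digits (k : fieldType) (p n : nat) (A C : nat -> 'M[k]_n.+1) N l e :
  p \in [pchar k] -> (2 * n.+1 <= p)%N ->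
  divided_powers A -> divided_powers C ->
  (0 < l <= N)%N -> (p ^ e.+1 %| N)%N -> ~~ (p ^ e.+1 %| l)%N -> (p ^ e %| l)%N ->
  C l = 0 \/ A (N - l)%N = 0.
Proof.
move=> hp hpd dA dC /andP[l0 lN] /dvdnP[N' NE] nl /dvdnP[l' lE].
have pr := pcharf_prime hp; have p0 := prime_gt0 pr.
have P0 : (0 < p ^ e)%N by rewrite expn_gt0 p0.
have E1 : (l %/ p ^ e = l')%N by rewrite lE mulnK.
have E2 : ((N - l) %/ p ^ e = N' * p - l')%N.
  by rewrite NE lE expnS mulnA -mulnBl mulnK.
have l'N : (l' <= N' * p)%N.
  by rewrite -(leq_pmul2r P0) -lE -mulnA -expnS -NE.
have t0 : (0 < l' %% p)%N.
  rewrite lt0n; apply: contra nl; by rewrite lE expnS dvdn_pmul2r.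
have sum : ((l' %% p) + ((N' * p - l') %% p) = p)%N.
  have : (p %| (l' %% p) + ((N' * p - l') %% p))%N.
    by rewrite /dvdn modnDm subnKC // modnMl.
  case/dvdnP=> c; have := ltn_pmod l' p0; have := ltn_pmod (N' * p - l') p0.
  (* A positive multiple of p below 2 p is p. *)
  case: c => [|[|c]]; [|by rewrite mul1n|].
    by move=> _ _ /eqP; rewrite mul0n addn_eq0 (gtn_eqF t0).
  move=> lt1 lt2 E; have := leq_add lt1 (ltnW lt2).
  rewrite addSn [X in (X < _)%N]addnC E ltnNge !mulSn addnA.
  by rewrite leq_addr.
have [nt|tn] := ltnP n (l' %% p); [left|right].
  by apply: (dp_digit_vanish hp dC (j := e)); rewrite E1.
apply: (dp_digit_vanish hp dA (j := e)); rewrite E2 ltnNge; apply/negP => t'n.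
move: hpd; rewrite -sum leqNgt => /negP; apply.
by rewrite mul2n -addnn addSn ltnS addnS ltnW // ltnS leq_add.
Qed.

(** * Commutation between the layers *)

Section Layers.
Variables (k : fieldType) (p n : nat).
Hypotheses (hp : p \in [pchar k]) (hpd : (2 * n.+1 <= p)%N).
Variables A B C : nat -> 'M[k]_n.+1.
Hypotheses (dA : divided_powers A) (dB : divided_powers B) (dC : divided_powers C).
Hypothesis AB : forall a b,
  A a * B b = \sum_(l < (minn a b).+1) B (b - l)%N * C l * A (a - l)%N.

(** In the exchange relation for a = p^i and b = p^j, the term l = 0 is the
    reversed product, and every other term is killed by [complementary_digits],
    applied to B and C or to A and C according to which of p^i, p^j exceeds l;
    this leaves l = p^i = p^j. *)
Lemma layer_commutator i j :
  commutator (A (p ^ i)%N) (B (p ^ j)%N) = if i == j then C (p ^ i)%N else 0.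
Proof.
have pr := pcharf_prime hp; have p1 := prime_gt1 pr; have p0 := ltnW p1.
have vanish l : (0 < l <= minn (p ^ i) (p ^ j))%N -> (l < maxn (p ^ i) (p ^ j))%N ->
    B (p ^ j - l)%N * C l * A (p ^ i - l)%N = 0.
  move=> /andP[l0]; rewrite leq_min => /andP[li lj] lmax.
  have [e p_l eE] : exists2 e, (~~ (p ^ e.+1 %| l)%N) & (p ^ e %| l)%N.
    exists (logn p l); first by rewrite pfactor_dvdn // ltnn.
    by rewrite pfactor_dvdn.
  have eb b : (l < p ^ b)%N -> (p ^ e.+1 %| p ^ b)%N.
    move=> lb; rewrite dvdn_Pexp2l // -(ltn_exp2l _ _ p1).
    by apply: leq_ltn_trans lb; apply: dvdn_leq.
  move: lmax; rewrite leq_max => /orP[lt|lt].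
    have [-> | ->] : C l = 0 \/ A (p ^ i - l)%N = 0.
    - by apply: (complementary_digits hp hpd dA dC _ (eb _ lt)); rewrite ?l0.
    - by rewrite mulr0 mul0r.
    - by rewrite mulr0.
  have [-> | ->] : C l = 0 \/ B (p ^ j - l)%N = 0.
  - by apply: (complementary_digits hp hpd dB dC _ (eb _ lt)); rewrite ?l0.
  - by rewrite mulr0 mul0r.
  - by rewrite !mul0r.
apply/eqP; rewrite /commutator subr_eq !mulmxE AB big_ord_recl !subn0 dC.1 mulr1 addrC.
apply/eqP; congr (_ + _); have [ij|ij] := eqVneq i j.
  rewrite ij minnn maxnn in vanish *; rewrite {ij}.
  have P0 : (0 < p ^ j)%N by rewrite expn_gt0 p0.
  case: (p ^ j)%N P0 vanish => // P _ vanish.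
  rewrite big_ord_recr /= big1 => [|l _]; last first.
    by rewrite vanish // /bump ?leq0n add1n /= ?ltnS // ltnW.
  by rewrite /bump ?leq0n add1n subnn dA.1 dB.1 mulr1 mul1r add0r.
rewrite big1 // => l _; rewrite !lift0 vanish ?ltn_ord //.
apply: leq_ltn_trans (ltn_ord l) _; rewrite /minn /maxn.
by case: (ltngtP (p ^ i) (p ^ j)) => // /expnI => /(_ p1)/eqP; rewrite (negPf ij).
Qed.

End Layers.

(** * Representations as functions on points *)

Lemma mpoly_rmorph_ext (k : fieldType) m (L : comNzRingType)
    (F G : {rmorphism {mpoly k[m]} -> L}) :
  (forall c, F c%:MP = G c%:MP) -> (forall i, F 'X_i = G 'X_i) -> F =1 G.
Proof.
move=> FGc FGX; elim/mpolyind => [|c mn q _ _ IH]; first by rewrite !rmorph0.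
rewrite !rmorphD IH -mul_mpolyC !rmorphM FGc mpolyXE_id !rmorph_prod.
by congr (_ * _ + _); apply: eq_bigr => i _; rewrite !rmorphXn FGX.
Qed.

Section Points.
Variables (k : fieldType) (n : nat) (M : 'M[{mpoly k[3]}]_n.+1).
Hypothesis repM : is_representation M.

Definition ix : 'I_3 := @Ordinal 3 0 isT.
Definition iy : 'I_3 := @Ordinal 3 1 isT.
Definition iz : 'I_3 := @Ordinal 3 2 isT.

Lemma ord3P (i : 'I_3) : [\/ i = ix, i = iy | i = iz].
Proof.
by case: i => [[|[|[|//]]]] lt; [apply: Or31|apply: Or32|apply: Or33]; apply: val_inj.
Qed.

Definition at_pt (L : comNzRingType) (phi : {rmorphism k -> L}) (g : 'I_3 -> L) :=
  map_mx (mmap phi g) M.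

(** The group law (x, y, z) (x', y', z') = (x + x', y + y', z + x y' + z'). *)
Definition heis_mul (L : comNzRingType) (g h : 'I_3 -> L) : 'I_3 -> L :=
  fun i => g i + (if i == iz then g ix * h iy else 0) + h i.

(** Evaluating the comodule axiom at a pair of points. *)
Lemma at_ptM (L : comNzRingType) (phi : {rmorphism k -> L}) g h :
  at_pt phi g * at_pt phi h = at_pt phi (heis_mul g h).
Proof.
pose gh (i : 'I_(3 + 3)) := match split i with inl j => g j | inr j => h j end.
have evl : mmap phi gh \o @inl_tens k =1 mmap phi g.
  apply: mpoly_rmorph_ext => [c|i] /=; first by rewrite /inl_tens comp_mpolyC !mmapC.
  by rewrite /inl_tens /comp_mpoly !mmapX !mmap1U tnth_mktuple mmapX mmap1U /gh (unsplitK (inl i)).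
have evr : mmap phi gh \o @inr_tens k =1 mmap phi h.
  apply: mpoly_rmorph_ext => [c|i] /=; first by rewrite /inr_tens comp_mpolyC !mmapC.
  by rewrite /inr_tens /comp_mpoly !mmapX !mmap1U tnth_mktuple mmapX mmap1U /gh (unsplitK (inr i)).
have evm : mmap phi gh \o @comul k =1 mmap phi (heis_mul g h).
  apply: mpoly_rmorph_ext => [c|i] /=; first by rewrite /comul comp_mpolyC !mmapC.
  rewrite /comul comp_mpolyXU mmapX mmap1U.
  have el q : mmap phi gh (inl_tens q) = mmap phi g q by exact: evl.
  have er q : mmap phi gh (inr_tens q) = mmap phi h q by exact: evr.
  have tE q q' : mmap phi gh (tens q q') = mmap phi g q * mmap phi h q'.
    by rewrite /tens rmorphM /= el er.
  case: (ord3P i) => -> /=; rewrite !rmorphD /= !tE !mmapX !mmap1U !rmorph1 ?mulr1 ?mul1r //.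
  - by rewrite /heis_mul addr0.
  - by rewrite /heis_mul addr0.
apply/matrixP => i j; rewrite !mxE -[RHS]evm /= repM.1 rmorph_sum.
by apply: eq_bigr => l _; rewrite !mxE rmorphM; congr (_ * _); rewrite -1?evl -1?evr.
Qed.

Lemma at_pt0 (L : comNzRingType) (phi : {rmorphism k -> L}) g :
  (forall i, g i = 0) -> at_pt phi g = 1.
Proof.
move=> g0; apply/matrixP => i j; rewrite !mxE.
have -> : mmap phi g (M i j) = phi (counit (M i j)).
  apply: (mpoly_rmorph_ext (F := mmap phi g) (G := phi \o @counit k)) => [c|l] /=.
    by rewrite /counit mevalC mmapC.
  by rewrite /counit mevalXU mmapX mmap1U g0 rmorph0.
by rewrite repM.2 rmorph_nat.
Qed.

Lemma at_pt_ext (L : comNzRingType) (phi : {rmorphism k -> L}) g h :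
  g =1 h -> at_pt phi g = at_pt phi h.
Proof.
move=> gh; apply/matrixP => i j; rewrite !mxE.
apply: (mpoly_rmorph_ext (F := mmap phi g) (G := mmap phi h)) => [c|l] /=.
  by rewrite !mmapC.
by rewrite !mmapX !mmap1U.
Qed.

Definition axis_pt (L : comNzRingType) (i : 'I_3) (a : L) : 'I_3 -> L :=
  fun j => if j == i then a else 0.

Lemma heis_mul_axis (L : comNzRingType) i (a b : L) :
  heis_mul (axis_pt i a) (axis_pt i b) =1 axis_pt i (a + b).
Proof.
move=> j; rewrite /heis_mul /axis_pt.
by case: (ord3P i) (ord3P j) => -> [] -> /=; rewrite ?mulr0 ?mul0r ?addr0.
Qed.

Definition axis_coef i m : 'M[k]_n.+1 :=
  map_mx (coefp m) (at_pt (@polyC k) (axis_pt i 'X)).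

(** The bound on the degree is uniform, so one number of terms serves every
    algebra, axis and parameter. *)
Lemma axis_expand : exists N0, forall (L : comNzRingType) (phi : {rmorphism k -> L}) i a N,
  (N0 <= N)%N ->
  at_pt phi (axis_pt i a) = \sum_(m < N) a ^+ m *: map_mx phi (axis_coef i m).
Proof.
exists (\max_i \max_r \max_s size (at_pt (@polyC k) (axis_pt i 'X) r s)).
move=> L phi i a N leN; apply/matrixP => r s; rewrite summxE mxE.
have -> : mmap phi (axis_pt i a) (M r s)
    = (map_poly phi (mmap (@polyC k) (axis_pt i 'X) (M r s))).[a].
  pose G := horner_eval a \o map_poly phi \o mmap (@polyC k) (axis_pt i 'X).
  apply: (mpoly_rmorph_ext (F := mmap phi (axis_pt i a)) (G := G)) => [c|l] /=.
    by rewrite !mmapC /= map_polyC /= /horner_eval hornerC.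
  rewrite !mmapX !mmap1U /horner_eval /axis_pt; case: eqP => _; last by rewrite rmorph0 horner0.
  by rewrite map_polyX hornerX.
rewrite (@horner_coef_wide _ N) => [|].
  by apply: eq_bigr => m _; rewrite !mxE coef_map mulrC.
rewrite (leq_trans (size_poly _ _)) // (leq_trans _ leN) //.
rewrite -[size _]/(size _) (leq_trans _ (leq_bigmax i)) // (leq_trans _ (leq_bigmax r)) //.
by rewrite (leq_trans _ (leq_bigmax s)) // mxE.
Qed.

End Points.

(** * Relations between the coefficients along the axes *)

Lemma monomial_exchange (L : comNzRingType) (x y : L) i j l :
  y ^+ j * (x * y) ^+ l * x ^+ i = x ^+ (i + l) * y ^+ (j + l).
Proof.
by rewrite !exprD exprMn; move: (x ^+ i) (x ^+ l) (y ^+ j) (y ^+ l) => *; ring.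
Qed.

(** Relations are read off at the two independent parameters ['X] and ['X%:P] of
    k[Y][X]. *)
Section Coefficients.
Variables (k : fieldType) (n : nat).
Local Notation L2 := {poly {poly k}}.
Let cst2 : {rmorphism k -> L2} := @polyC _ \o @polyC k.

Definition mxcoef a b (N : 'M[L2]_n.+1) : 'M[k]_n.+1 :=
  \matrix_(i, j) (N i j)`_a`_b.

Lemma mxcoef_sum a b (I : Type) (r : seq I) (P : pred I) F :
  mxcoef a b (\sum_(i <- r | P i) F i) = \sum_(i <- r | P i) mxcoef a b (F i).
Proof.
apply/matrixP => i j; rewrite !mxE !summxE !coef_sum.
by apply: eq_bigr => l _; rewrite mxE.
Qed.

Lemma mxcoefZ a b u (N : 'M[k]_n.+1) :
  mxcoef a b (u *: map_mx cst2 N) = u`_a`_b *: N.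
Proof. by apply/matrixP => i j; rewrite !mxE /= !coefMC. Qed.

Lemma coefXY a b i j : (('X^i * 'X%:P ^+ j : L2)`_a)`_b = ((i == a) && (j == b))%:R.
Proof.
rewrite -polyC_exp coefMC coefXn mulrC eq_sym; case: eqP => _.
  by rewrite mulr1 coefXn eq_sym.
by rewrite mulr0 coef0.
Qed.

Lemma sum_pick N a b (F : nat -> nat -> 'M[k]_n.+1) : (a < N)%N -> (b < N)%N ->
  \sum_(i < N) \sum_(j < N) ((i == a :> nat) && (j == b :> nat))%:R *: F i j = F a b.
Proof.
move=> aN bN; rewrite (bigD1 (Ordinal aN)) //= [X in _ + X]big1 => [|i ia]; last first.
  by apply: big1 => j _; rewrite [_ == a](negPf ia) scale0r.
rewrite addr0 (bigD1 (Ordinal bN)) //= [X in _ + X]big1 => [|j jb]; last first.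
  by rewrite [_ == b](negPf jb) andbF scale0r.
by rewrite !eqxx scale1r addr0.
Qed.

Lemma mulr_sumZ (L : comNzRingType) (phi : {rmorphism k -> L}) N1 N2
    (u v : nat -> L) (F G : nat -> 'M[k]_n.+1) :
  (\sum_(i < N1) u i *: map_mx phi (F i)) * (\sum_(j < N2) v j *: map_mx phi (G j)) =
  \sum_(i < N1) \sum_(j < N2) (u i * v j) *: map_mx phi (F i * G j).
Proof.
rewrite mulr_suml; apply: eq_bigr => i _; rewrite mulr_sumr; apply: eq_bigr => j _.
by rewrite -scalerAl -scalerAr scalerA map_mxM.
Qed.

Lemma mxcoef_mul N a b (F G : nat -> 'M[k]_n.+1) : (a < N)%N -> (b < N)%N ->
  mxcoef a b ((\sum_(i < N) 'X^i *: map_mx cst2 (F i)) *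
              (\sum_(j < N) 'X%:P ^+ j *: map_mx cst2 (G j))) = F a * G b.
Proof.
move=> aN bN; rewrite (mulr_sumZ cst2 _ _ (fun i => 'X^i) (fun j => 'X%:P ^+ j)).
rewrite mxcoef_sum -(sum_pick (fun i j => F i * G j) aN bN).
apply: eq_bigr => i _; rewrite mxcoef_sum; apply: eq_bigr => j _.
by rewrite mxcoefZ coefXY.
Qed.

Lemma mxcoef_mul_swap N a b (F G : nat -> 'M[k]_n.+1) : (a < N)%N -> (b < N)%N ->
  mxcoef a b ((\sum_(j < N) 'X%:P ^+ j *: map_mx cst2 (G j)) *
              (\sum_(i < N) 'X^i *: map_mx cst2 (F i))) = G b * F a.
Proof.
move=> aN bN; rewrite (mulr_sumZ cst2 _ _ (fun j => 'X%:P ^+ j) (fun i => 'X^i)).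
rewrite mxcoef_sum -(sum_pick (fun j i => G j * F i) bN aN).
apply: eq_bigr => j _; rewrite mxcoef_sum; apply: eq_bigr => i _.
by rewrite mxcoefZ mulrC coefXY andbC.
Qed.

Lemma mxcoef_addX N a b (F : nat -> 'M[k]_n.+1) : (a + b < N)%N ->
  mxcoef a b (\sum_(l < N) ('X + 'X%:P) ^+ l *: map_mx cst2 (F l)) =
  F (a + b)%N *+ 'C(a + b, a).
Proof.
move=> abN; rewrite mxcoef_sum.
have cE l : ((('X + 'X%:P : L2) ^+ l)`_a)`_b = (if l == (a + b)%N then 'C(a + b, a) else 0)%:R.
  rewrite exprDn !coef_sum.
  under eq_bigr => i _ do rewrite !coefMn coefXY.
  case: eqP => [->|lab].
    have bl : (b < (a + b).+1)%N by rewrite ltnS leq_addl.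
    rewrite (bigD1 (Ordinal bl)) //= big1 => [|i ib]; last first.
      by rewrite [_ == b](negPf ib) andbF mul0rn.
    by rewrite addnK !eqxx addr0 -[in RHS]bin_sub ?leq_addr // addKn.
  rewrite big1 // => i _; case: eqP => [ia|]; last by rewrite mul0rn.
  case: eqP => [ib|]; last by rewrite mul0rn.
  by case: lab; rewrite -ia -ib subnK // -ltnS.
rewrite (bigD1 (Ordinal abN)) //= big1 ?addr0 => [|l ll]; last first.
  by rewrite mxcoefZ cE [_ == _](negPf ll) scale0r.
by rewrite mxcoefZ cE eqxx scaler_nat.
Qed.

Lemma mxcoef_exchange N a b (A B C : nat -> 'M[k]_n.+1) : (a < N)%N -> (b < N)%N ->
  mxcoef a b ((\sum_(j < N) 'X%:P ^+ j *: map_mx cst2 (B j)) *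
              (\sum_(l < N) ('X * 'X%:P) ^+ l *: map_mx cst2 (C l)) *
              (\sum_(i < N) 'X^i *: map_mx cst2 (A i))) =
  \sum_(l < (minn a b).+1) B (b - l)%N * C l * A (a - l)%N.
Proof.
move=> aN bN.
rewrite (mulr_sumZ cst2 _ _ (fun j => 'X%:P ^+ j) (fun l => ('X * 'X%:P) ^+ l)).
rewrite mulr_suml mxcoef_sum.
under eq_bigr => j _.
  rewrite (mulr_sumZ cst2 _ _ (fun l => 'X%:P ^+ j * ('X * 'X%:P) ^+ l) (fun i => 'X^i)
     (fun l => B j * C l)) mxcoef_sum.
  under eq_bigr => l _ do rewrite mxcoef_sum.
  over.
rewrite exchange_big /=.
have mN : ((minn a b).+1 <= N)%N by rewrite gtn_min aN.
rewrite (big_ord_widen _ (fun l => B (b - l)%N * C l * A (a - l)%N) mN) [RHS]big_mkcond.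
apply: eq_bigr => l _; rewrite ltnS leq_min; case: ifP => [/andP[la lb]|nl].
  have aN' := leq_ltn_trans (leq_subr l a) aN.
  have bN' := leq_ltn_trans (leq_subr l b) bN.
  rewrite -(sum_pick (fun j i => B j * C l * A i) bN' aN').
  apply: eq_bigr => j _; apply: eq_bigr => i _; rewrite mxcoefZ.
  rewrite (monomial_exchange 'X 'X%:P).
  by rewrite coefXY andbC -(eqn_add2r l j) subnK // -(eqn_add2r l i) subnK.
apply: big1 => j _; apply: big1 => i _; rewrite mxcoefZ.
rewrite (monomial_exchange 'X 'X%:P).
rewrite coefXY; case: eqP => [ila|]; last by rewrite scale0r.
case: eqP => [jlb|]; last by rewrite scale0r.
by move: nl; rewrite -ila -jlb !leq_addl.
Qed.

Variable M : 'M[{mpoly k[3]}]_n.+1.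
Hypothesis repM : is_representation M.
Local Notation crd := (axis_coef M).

(** From (axis_pt i a) (axis_pt i b) = axis_pt i (a + b). *)
Lemma axis_divided_powers i : divided_powers (crd i).
Proof.
have [N0 ex] := axis_expand M; split.
  have := ex _ idfun i 0 N0.+1 (leqnSn _).
  rewrite big_ord_recl big1 => [|l _]; last by rewrite /= /bump exprS mul0r scale0r.
  rewrite addr0 expr0 scale1r map_mx_id // => <-; apply: at_pt0 => // j.
  by rewrite /axis_pt; case: eqP.
move=> a b; pose N := (N0 + (a + b).+1)%N.
have abN : (a + b < N)%N by rewrite /N leq_addl.
have aN : (a < N)%N by apply: leq_ltn_trans abN; rewrite leq_addr.
have bN : (b < N)%N by apply: leq_ltn_trans abN; rewrite leq_addl.
have := at_ptM repM cst2 (axis_pt i 'X) (axis_pt i 'X%:P).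
have le : (N0 <= N)%N by rewrite leq_addr.
rewrite (at_pt_ext M _ (heis_mul_axis i _ _)) !(ex _ cst2 i _ N le).
move/(congr1 (mxcoef a b)); rewrite (mxcoef_mul (crd i) (crd i) aN bN).
by rewrite (mxcoef_addX (crd i) abN).
Qed.

(** From the centrality of the points (0, 0, z). *)
Lemma axis_central i a b : crd i a * crd iz b = crd iz b * crd i a.
Proof.
have [N0 ex] := axis_expand M; pose N := (N0 + (a + b).+1)%N.
have abN : (a + b < N)%N by rewrite /N leq_addl.
have aN : (a < N)%N by apply: leq_ltn_trans abN; rewrite leq_addr.
have bN : (b < N)%N by apply: leq_ltn_trans abN; rewrite leq_addl.
have E : heis_mul (axis_pt i 'X) (axis_pt iz 'X%:P) =1
    heis_mul (axis_pt iz 'X%:P) (axis_pt i ('X : L2)).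
  move=> j; rewrite /heis_mul /axis_pt.
  by case: (ord3P i) (ord3P j) => -> [] -> /=; rewrite ?mulr0 ?mul0r ?addr0 ?add0r // addrC.
have := at_ptM repM cst2 (axis_pt i 'X) (axis_pt iz 'X%:P).
have le : (N0 <= N)%N by rewrite leq_addr.
rewrite (at_pt_ext M _ E) -(at_ptM repM) (ex _ cst2 i 'X N le) (ex _ cst2 iz 'X%:P N le).
move/(congr1 (mxcoef a b)) => coefE.
exact: etrans (esym (mxcoef_mul (crd i) (crd iz) aN bN))
  (etrans coefE (mxcoef_mul_swap (crd i) (crd iz) aN bN)).
Qed.

(** From (x, 0, 0) (0, y, 0) = (0, y, 0) (0, 0, x y) (x, 0, 0). *)
Lemma axis_exchange a b : crd ix a * crd iy b =
  \sum_(l < (minn a b).+1) crd iy (b - l)%N * crd iz l * crd ix (a - l)%N.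
Proof.
have [N0 ex] := axis_expand M; pose N := (N0 + (a + b).+1)%N.
have abN : (a + b < N)%N by rewrite /N leq_addl.
have aN : (a < N)%N by apply: leq_ltn_trans abN; rewrite leq_addr.
have bN : (b < N)%N by apply: leq_ltn_trans abN; rewrite leq_addl.
have E : heis_mul (axis_pt ix 'X) (axis_pt iy 'X%:P) =1
   heis_mul (heis_mul (axis_pt iy 'X%:P) (axis_pt iz ('X * 'X%:P))) (axis_pt ix ('X : L2)).
  move=> j; rewrite /heis_mul /axis_pt.
  by case: (ord3P j) => -> /=; rewrite ?mulr0 ?mul0r ?addr0 ?add0r.
have := at_ptM repM cst2 (axis_pt ix 'X) (axis_pt iy 'X%:P).
have le : (N0 <= N)%N by rewrite leq_addr.
rewrite (at_pt_ext M _ E) -!(at_ptM repM) (ex _ cst2 ix 'X N le).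
rewrite (ex _ cst2 iy 'X%:P N le) (ex _ cst2 iz ('X * 'X%:P) N le).
move/(congr1 (mxcoef a b)) => coefE.
exact: etrans (esym (mxcoef_mul (crd ix) (crd iy) aN bN))
  (etrans coefE (mxcoef_exchange (crd ix) (crd iy) (crd iz) aN bN)).
Qed.

End Coefficients.

(** * The two directions *)

Lemma prodrM_comm_neq (R : pzRingType) (I : eqType) (r : seq I) (F G : I -> R) :
  uniq r -> (forall i j, i != j -> F i * G j = G j * F i) ->
  \prod_(i <- r) (F i * G i) = \prod_(i <- r) F i * \prod_(i <- r) G i.
Proof.
move=> + FG; elim: r => [|i r IH] /=; first by rewrite !big_nil mulr1.
case/andP => ir ur; rewrite !big_cons IH // -!mulrA; congr (_ * _); rewrite !mulrA.
congr (_ * _); rewrite big_seq; apply: commr_prod => j jr.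
by apply/esym/FG; apply: contraNneq ir => <-.
Qed.

Section Collection.
Variables (k : fieldType) (p n : nat).
Hypotheses (hp : p \in [pchar k]) (hpd : (2 * n.+1 <= p)%N).

Section Factor.
Variables (L : comNzRingType) (phi : {rmorphism k -> L}).

(** The i-th factor of the formula, for q = p^i, evaluated at (x, y, z). *)
Definition heis_factor (q : nat) (X Y Z : 'M[k]_n.+1) (x y z : L) :=
  texp p phi (heis_lin phi X Y Z (x ^+ q) (y ^+ q) (z ^+ q - phi 2%:R^-1 * (x ^+ q * y ^+ q))).

Lemma heis_formula_rmorph (F : {rmorphism {mpoly k[3]} -> L}) m X Y Z :
  (forall c, F c%:MP = phi c) ->
  map_mx F (heis_formula p X Y Z) =
  \prod_(i < m.+1) heis_factor (p ^ i)%N (X i) (Y i) (Z i) (F (hx k)) (F (hy k)) (F (hz k)).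
Proof.
move=> Fc; rewrite /heis_formula rmorph_prod; apply: eq_bigr => i _ /=.
have cst N : map_mx F (map_mx (@mpolyC 3 k) N) = map_mx phi N.
  by rewrite -map_mx_comp; apply/matrixP => r s; rewrite !mxE /= Fc.
rewrite /trunc_exp rmorph_sum; apply: eq_bigr => j _ /=.
rewrite map_mxZ Fc rmorphXn /=; congr (_ *: _ ^+ _).
rewrite /exponent /heis_lin !map_mxD !map_mxZ !cst !rmorphXn rmorphB -mul_mpolyC !rmorphM Fc.
by rewrite !rmorphXn.
Qed.

(** Raising to the power p^e is additive, so this is [texpM] after the change
    of coordinate z - x y / 2. *)
Lemma heis_factorM e X Y Z x y z x' y' z' :
  nilpotent_mx X -> nilpotent_mx Y -> nilpotent_mx Z ->
  commutator X Y = Z -> commutator Z X = 0 -> commutator Z Y = 0 ->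
  heis_factor (p ^ e) X Y Z x y z * heis_factor (p ^ e) X Y Z x' y' z' =
  heis_factor (p ^ e) X Y Z (x + x') (y + y') (z + z' + x * y').
Proof.
move=> nX nY nZ XY ZX ZY.
have pL : p \in [pchar L] by exact: rmorph_pchar hp.
have frob (a b : L) : (a + b) ^+ (p ^ e) = a ^+ (p ^ e) + b ^+ (p ^ e).
  by apply: exprDn_pchar; rewrite pnatX pnatE ?(pcharf_prime hp) // pL.
rewrite /heis_factor (texpM hp) // !frob exprMn; congr (texp _ _ _).
move: (x ^+ _) (y ^+ _) (z ^+ _) (x' ^+ _) (y' ^+ _) (z' ^+ _) => {}x {}y {}z {}x' {}y' {}z'.
have [Z0|h2] : Z = 0 \/ phi 2%:R^-1 *+ 2 = 1.
  exact: (half_mul2_or_eq0 hp hpd phi nX nY nZ XY ZX ZY).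
- by rewrite Z0 /heis_lin map_mx0 !scaler0.
move: (phi 2%:R^-1) h2 => h h2; rewrite /heis_lin; congr (_ + _ *: _).
(* Writing x y' as 2 h x y', with h = 1/2, makes this an identity in h. *)
have E : x * y' = h *+ 2 * (x * y') by rewrite h2 mul1r.
by rewrite [in RHS]E; ring.
Qed.

End Factor.

Lemma heis_factor_comm (L : comNzRingType) (phi : {rmorphism k -> L})
    q X Y Z x y z q' X' Y' Z' x' y' z' :
  (forall M N, M \in [:: X; Y; Z] -> N \in [:: X'; Y'; Z'] -> commutator M N = 0) ->
  heis_factor phi q X Y Z x y z * heis_factor phi q' X' Y' Z' x' y' z' =
  heis_factor phi q' X' Y' Z' x' y' z' * heis_factor phi q X Y Z x y z.
Proof. by move=> cM; apply: texp_comm; apply: heis_lin_comm. Qed.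

Lemma prod_heis_factorM (L : comNzRingType) (phi : {rmorphism k -> L})
    m (X Y Z : 'I_m.+1 -> 'M[k]_n.+1) x y z x' y' z' :
  heis_collection X Y Z ->
  (\prod_(i < m.+1) heis_factor phi (p ^ i)%N (X i) (Y i) (Z i) x y z) *
  (\prod_(i < m.+1) heis_factor phi (p ^ i)%N (X i) (Y i) (Z i) x' y' z') =
  \prod_(i < m.+1) heis_factor phi (p ^ i)%N (X i) (Y i) (Z i) (x + x') (y + y') (z + z' + x * y').
Proof.
case=> nil rel com.
rewrite -(prodrM_comm_neq (F := fun i : 'I_m.+1 =>
    heis_factor phi (p ^ i)%N (X i) (Y i) (Z i) x y z)
  (G := fun i : 'I_m.+1 => heis_factor phi (p ^ i)%N (X i) (Y i) (Z i) x' y' z'))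
  ?index_enum_uniq // => [|a b ab]; last first.
  by apply: heis_factor_comm => M N; apply: com.
apply: eq_bigr => a _; have [nX nY nZ] := nil a; have [XY ZX ZY] := rel a.
by rewrite heis_factorM.
Qed.

(** (x, y, z) is the product (0, y, 0) (0, 0, z) (x, 0, 0); factors of different
    layers commute, so the product can be taken layer by layer. *)
Lemma prod_axis_factors (L : comNzRingType) (phi : {rmorphism k -> L})
    m (X Y Z : 'I_m.+1 -> 'M[k]_n.+1) x y z :
  heis_collection X Y Z ->
  (\prod_(i < m.+1) texp p phi (y ^+ (p ^ i) *: map_mx phi (Y i))) *
  (\prod_(i < m.+1) texp p phi (z ^+ (p ^ i) *: map_mx phi (Z i))) *
  (\prod_(i < m.+1) texp p phi (x ^+ (p ^ i) *: map_mx phi (X i))) =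
  \prod_(i < m.+1) heis_factor phi (p ^ i)%N (X i) (Y i) (Z i) x y z.
Proof.
case=> nil rel com.
pose eX (i : 'I_m.+1) := texp p phi (x ^+ (p ^ i) *: map_mx phi (X i)).
pose eY (i : 'I_m.+1) := texp p phi (y ^+ (p ^ i) *: map_mx phi (Y i)).
pose eZ (i : 'I_m.+1) := texp p phi (z ^+ (p ^ i) *: map_mx phi (Z i)).
have cross A B u v : commutator A B = 0 ->
    texp p phi (u *: map_mx phi A) * texp p phi (v *: map_mx phi B) =
    texp p phi (v *: map_mx phi B) * texp p phi (u *: map_mx phi A).
  move=> AB; apply: texp_comm; rewrite -!scalerAl -!scalerAr !scalerA mulrC.
  congr (_ *: _); apply/eqP; rewrite -subr_eq0 -!mulmxE -!map_mxM -map_mxB.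
  by rewrite [_ - _]AB map_mx0.
have cYZ i j : i != j -> eY i * eZ j = eZ j * eY i.
  by move=> ij; apply: cross; apply: (com _ _ ij); rewrite !inE eqxx ?orbT.
have cX i j : i != j -> (eY i * eZ i) * eX j = eX j * (eY i * eZ i).
  move=> ij; rewrite -mulrA [eZ i * _]cross ?mulrA; last first.
    by apply: (com _ _ ij); rewrite !inE eqxx ?orbT.
  rewrite [eY i * _]cross ?mulrA //.
  by apply: (com _ _ ij); rewrite !inE eqxx ?orbT.
rewrite -(prodrM_comm_neq (F := eY) (G := eZ)) ?index_enum_uniq //.
rewrite -(prodrM_comm_neq (F := fun i => eY i * eZ i) (G := eX)) ?index_enum_uniq //.
apply: eq_bigr => i _; rewrite /eX /eY /eZ /heis_factor.
have [nX nY nZ] := nil i; have [XY ZX ZY] := rel i.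
have linX u : u *: map_mx phi (X i) = heis_lin phi (X i) (Y i) (Z i) u 0 0.
  by rewrite /heis_lin !scale0r !addr0.
have linY u : u *: map_mx phi (Y i) = heis_lin phi (X i) (Y i) (Z i) 0 u 0.
  by rewrite /heis_lin !scale0r addr0 add0r.
have linZ u : u *: map_mx phi (Z i) = heis_lin phi (X i) (Y i) (Z i) 0 0 u.
  by rewrite /heis_lin !scale0r !add0r.
rewrite linX linY linZ !(texpM hp) //.
by congr (texp _ _ (heis_lin _ _ _ _ _ _ _)); ring.
Qed.

Lemma heis_formula_representation m (X Y Z : 'I_m.+1 -> 'M[k]_n.+1) :
  heis_collection X Y Z -> is_representation (heis_formula p X Y Z).
Proof.
case=> nil rel com; split=> i j.
- pose phi : {rmorphism k -> {mpoly k[6]}} := @mpolyC 6 k.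
  have Cc c : comul c%:MP = phi c by exact: comp_mpolyC.
  have Lc c : inl_tens c%:MP = phi c by exact: comp_mpolyC.
  have Rc c : inr_tens c%:MP = phi c by exact: comp_mpolyC.
  suff E : map_mx (@comul k) (heis_formula p X Y Z) =
     map_mx (@inl_tens k) (heis_formula p X Y Z) * map_mx (@inr_tens k) (heis_formula p X Y Z).
    have := congr1 (fun M : 'M_n.+1 => M i j) E; rewrite !mxE => ->.
    by apply: eq_bigr => l _; rewrite !mxE.
  rewrite (heis_formula_rmorph X Y Z Cc) (heis_formula_rmorph X Y Z Lc)
    (heis_formula_rmorph X Y Z Rc).
  rewrite (prod_heis_factorM phi _ _ _ _ _ _ (And3 nil rel com)).
  apply: eq_bigr => a _.
  have tE a' b' : tens a' b' = inl_tens a' * inr_tens b' by [].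
  have l1 : inl_tens 1 = 1 :> {mpoly k[6]} by exact: rmorph1.
  have r1 : inr_tens 1 = 1 :> {mpoly k[6]} by exact: rmorph1.
  have cx : comul (hx k) = inl_tens (hx k) + inr_tens (hx k).
    by rewrite /comul comp_mpolyXU /= !tE l1 r1 mulr1 mul1r.
  have cy : comul (hy k) = inl_tens (hy k) + inr_tens (hy k).
    by rewrite /comul comp_mpolyXU /= !tE l1 r1 mulr1 mul1r.
  have cz : comul (hz k) = inl_tens (hz k) + inr_tens (hz k) + inl_tens (hx k) * inr_tens (hy k).
    by rewrite /comul comp_mpolyXU /= !tE l1 r1 mulr1 mul1r addrAC.
  by rewrite -cx -cy -cz.
- have Cc (c : k) : @counit k c%:MP = c by exact: mevalC.
  have E := heis_formula_rmorph (F := @counit k) (phi := idfun) X Y Z Cc.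
  have -> : counit (heis_formula p X Y Z i j) = map_mx (@counit k) (heis_formula p X Y Z) i j.
    by rewrite mxE.
  rewrite E big1 => [|a _]; first by rewrite mxE.
  rewrite /= /hx /hy /hz !mevalXU /heis_factor.
  have p0 : (0 < p ^ a)%N by rewrite expn_gt0 prime_gt0 // (pcharf_prime hp).
  by rewrite !expr0n (gtn_eqF p0) /heis_lin mulr0 mulr0 subr0 !scale0r !addr0 texp0.
Qed.

(** The layers are X_i = A_(p^i), Y_i = B_(p^i), Z_i = C_(p^i) for the axis
    coefficients A, B, C of M. *)
Lemma representation_heis_formula (M : 'M[{mpoly k[3]}]_n.+1) :
  is_representation M ->
  exists (m : nat) (X Y Z : 'I_m.+1 -> 'M[k]_n.+1),
    heis_collection X Y Z /\ M = heis_formula p X Y Z.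
Proof.
move=> repM.
have dX := axis_divided_powers repM ix.
have dY := axis_divided_powers repM iy.
have dZ := axis_divided_powers repM iz.
have [N0 ex] := axis_expand M.
pose X (i : nat) := axis_coef M ix (p ^ i).
pose Y (i : nat) := axis_coef M iy (p ^ i).
pose Z (i : nat) := axis_coef M iz (p ^ i).
have commP (A B : 'M[k]_n.+1) : A * B = B * A -> commutator A B = 0.
  by rewrite /commutator !mulmxE => ->; rewrite subrr.
have commS (A B : 'M[k]_n.+1) : commutator A B = 0 -> commutator B A = 0.
  by rewrite /commutator => /eqP; rewrite subr_eq0 => /eqP ->; rewrite subrr.
have XY i j : commutator (X i) (Y j) = if i == j then Z i else 0.
  exact: (layer_commutator hp hpd dX dY dZ (axis_exchange repM)).
have nX i : nilpotent_mx (X i) by exact: (dp_nilpotent hp dX).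
have nY i : nilpotent_mx (Y i) by exact: (dp_nilpotent hp dY).
have nZ i : nilpotent_mx (Z i) by exact: (dp_nilpotent hp dZ).
have XX i j : commutator (X i) (X j) = 0 by apply: commP; exact: (dp_mulC dX).
have YY i j : commutator (Y i) (Y j) = 0 by apply: commP; exact: (dp_mulC dY).
have ZZ i j : commutator (Z i) (Z j) = 0 by apply: commP; exact: (dp_mulC dZ).
have XZ i j : commutator (X i) (Z j) = 0 by apply: commP; exact: (axis_central repM).
have YZ i j : commutator (Y i) (Z j) = 0 by apply: commP; exact: (axis_central repM).
have cross i j : i != j -> forall A B, A \in [:: X i; Y i; Z i] ->
    B \in [:: X j; Y j; Z j] -> commutator A B = 0.
  move=> ij A B; have ji : j != i by rewrite eq_sym.
  have := XY i j; have := XY j i; rewrite (negPf ij) (negPf ji) => XYji XYij.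
  rewrite !inE => /or3P[] /eqP -> /or3P[] /eqP ->; rewrite ?XX ?YY ?ZZ ?XZ ?YZ ?XYij //;
    by apply: commS.
have coll : heis_collection (fun i : 'I_N0.+1 => X i) (fun i => Y i) (fun i => Z i).
  split=> [i|i|i j ij]; first by split.
    by split; [rewrite XY eqxx | apply: commS | apply: commS].
  exact: cross.
(* The N0.+1 layers cover the degrees below p ^ N0.+1, hence below N0. *)
exists N0, (fun i : 'I_N0.+1 => X i), (fun i => Y i), (fun i => Z i); split=> //.
pose phi : {rmorphism k -> {mpoly k[3]}} := @mpolyC 3 k.
have idE F : map_mx idfun F = F :> 'M[{mpoly k[3]}]_n.+1 by exact: map_mx_id.
rewrite -[RHS]idE (heis_formula_rmorph (phi := phi)) //=.
pose x := hx k; pose y := hy k; pose z := hz k.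
have -> : M = at_pt M phi (heis_mul (heis_mul (axis_pt iy y) (axis_pt iz z)) (axis_pt ix x)).
  apply/matrixP => r s; rewrite mxE.
  set g := heis_mul _ _.
  apply: (mpoly_rmorph_ext (F := idfun) (G := mmap phi g)) => [c|i] /=.
    by rewrite mmapC.
  rewrite mmapX mmap1U /g /heis_mul /axis_pt.
  by case: (ord3P i) => -> /=; rewrite ?mulr0 ?mul0r ?addr0 ?add0r.
have le : (N0 <= p ^ N0.+1)%N.
  by rewrite ltnW // ltnW // ltn_expl // prime_gt1 // (pcharf_prime hp).
rewrite -!at_ptM // !(ex _ _ _ _ _ le).
rewrite (dp_prod hp dX) (dp_prod hp dY) (dp_prod hp dZ).
by rewrite (prod_axis_factors phi x y z coll).
Qed.

End Collection.

Theorem theorem1p3 (k : fieldType) (p d : nat)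
    (hp : p \in [pchar k]) (hd : (1 <= d)%N) (hpd : (2 * d <= p)%N) :
  (forall M : 'M[{mpoly k[3]}]_d, is_representation M ->
     exists (m : nat) (X Y Z : 'I_m.+1 -> 'M[k]_d),
       heis_collection X Y Z /\ M = heis_formula p X Y Z) /\
  (forall (m : nat) (X Y Z : 'I_m.+1 -> 'M[k]_d),
     heis_collection X Y Z -> is_representation (heis_formula p X Y Z)).
Proof.
case: d hd hpd => // n _ hpd; split.
  exact: representation_heis_formula.
exact: heis_formula_representation.
Qed.
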